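(* Let $A(\lambda)$ be a regular $n\times n$ matrix polynomial over a field $K$, and let $B_n(\lambda)$ and the unimodular matrix polynomial $V(\lambda)=V_n(\lambda)\cdots V_2(\lambda)$ be constructed from $A(\lambda)$ as described in the context. Then there is a unimodular matrix polynomial $E(\lambda)$ over $K$ such that $$A(\lambda)V(\lambda)=E(\lambda)D(\lambda),$$ where $D(\lambda)=\operatorname{diag}[d_1(\lambda),\dots,d_n(\lambda)]$ is the diagonal matrix of the Smith form of $A(\lambda)$, i.e. the $d_i$ are monic polynomials over $K$ and $d_{i-1}$ divides $d_i$ for $2\le i\le n$.
   Context: A square matrix polynomial is regular if its determinant is not identically zero, and unimodular if its determinant is a nonzero constant in $K$. A Smith form of a regular $A(\lambda)$ is a representation $A=EDF$ with $E,F$ unimodular matrix polynomials over $K$ and $D=\operatorname{diag}[d_1,\dots,d_n]$, with $d_i\in K[\lambda]$ monic and $d_{i-1}\mid d_i$; it exists and $D$ is unique. Write $\det[A(\lambda)]=c\prod_{j=1}^l p_j(\lambda)^{\kappa_j}$ with $0\ne c\in K$, $l\ge1$, $p_1,\dots,p_l$ distinct monic irreducible polynomials in $K[\lambda]$, and $\kappa_j\ge1$. Then $d_i=\prod_{j=1}^l p_j^{\kappa_{ji}}$ for $1\le i\le n$, with integers $0\le\kappa_{j1}\le\cdots\le\kappa_{jn}$, $\sum_{i=1}^n\kappa_{ji}=\kappa_j$. Local Smith forms: for each $j=1,\dots,l$ let $V_{(j)}(\lambda)$, $E_{(j)}(\lambda)$ be $n\times n$ matrix polynomials over $K$ with $A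 V_{(j)}=E_{(j)}\operatorname{diag}[p_j^{\kappa_{j1}},\dots,p_j^{\kappa_{jn}}]$, $p_j\nmid\det V_{(j)}$ and $p_j\nmid\det E_{(j)}$. Combination: let $g_1,\dots,g_l\in K[\lambda]$ satisfy $\deg g_j<\deg(p_j)\,\kappa_{jn}$ and $\sum_{j=1}^l g_j\prod_{k\ne j}p_k^{\kappa_{kn}}=1$, where the product is over $k\in\{1,\dots,l\}\setminus\{j\}$. Define $$B_n(\lambda)=\sum_{j=1}^l g_j(\lambda)\Big(\prod_{k\ne j}p_k(\lambda)^{\kappa_{kn}}\Big)V_{(j)}(\lambda).$$ Triangularization: for $i=n,n-1,\dots,2$ in turn, let $f\in K[\lambda]^i$ be the vector of the first $i$ components of column $i$ of $B_i(\lambda)$, choose a unimodular $i\times i$ matrix polynomial $Q(\lambda)$ over $K$ with $Q f=[0;\dots;0;r]$, where $r$ is the gcd of the components of $f$ (monic, or $0$ if $f=0$), and set $$V_i(\lambda)=\begin{pmatrix}Q(\lambda)^{-1}&0\\0&I_{n-i}\end{pmatrix},\qquad B_{i-1}(\lambda)=V_i(\lambda)^{-1}B_i(\lambda).$$ Thus $A B_n=A V B_1$ with $V=V_n\cdots V_2$ unimodular and $B_1$ lower triangular. *)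

(* Defs.v *)
From HB Require Import structures.
From mathcomp Require Import all_boot all_order all_algebra.

Set Implicit Arguments.
Unset Strict Implicit.
Unset Printing Implicit Defensive.

Import GRing.Theory.
Local Open Scope ring_scope.

(* An n x n matrix polynomial over the field K is an element of
   'M[{poly K}]_n. *)

Section MatrixPolynomials.

Variable K : fieldType.

Definition regular n (A : 'M[{poly K}]_n) : Prop := \det A != 0.

Definition unimodular n (A : 'M[{poly K}]_n) : Prop :=
  exists2 c : K, c != 0 & \det A = c%:P.

Definition diag_poly n (d : 'I_n -> {poly K}) : 'M[{poly K}]_n :=
  diag_mx (\row_i d i).

Definition is_smith_form n (A : 'M[{poly K}]_n) (d : 'I_n -> {poly K}) : Prop :=
  [/\ forall i, d i \is monic,
      forall i j : 'I_n, j = i.+1 :> nat -> d i %| d j &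
      exists E F : 'M[{poly K}]_n,
        [/\ unimodular E, unimodular F & A = E *m diag_poly d *m F]].

Definition is_local_smith_form n (p : {poly K}) (A : 'M[{poly K}]_n)
    (e : 'I_n -> nat) (V E : 'M[{poly K}]_n) : Prop :=
  [/\ A *m V = E *m diag_poly (fun i => p ^+ e i),
      ~~ (p %| \det V) & ~~ (p %| \det E)].

(* gcdp is only determined up to a nonzero scalar; dividing by the leading
   coefficient gives the monic gcd of the entries, and 0 for the zero vector. *)
Definition monic_gcd i (f : 'cV[{poly K}]_i) : {poly K} :=
  let g := \big[@gcdp K/0]_(r < i) f r 0 in (lead_coef g)^-1 *: g.

(* The matrices below have size n.+1, and i (a 1-based size or column index)
   is meant to satisfy 0 < i <= n.+1. *)

Definition col_head n i (B : 'M[{poly K}]_n.+1) : 'cV[{poly K}]_i :=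
  \col_(r < i) B (inord r) (inord i.-1).

(* When i <= n.+1 one has i + (n.+1 - i) = n.+1, and conform_mx only transports
   the block matrix along this equality. *)
Definition pad_mx n i (Q : 'M[{poly K}]_i) : 'M[{poly K}]_n.+1 :=
  conform_mx 1%:M
    (block_mx Q 0 0 1%:M : 'M[{poly K}]_(i + (n.+1 - i))).

Definition triangularization_step n i
    (B B' V : 'M[{poly K}]_n.+1) : Prop :=
  exists Q : 'M[{poly K}]_i,
    [/\ unimodular Q,
        Q *m col_head i B =
          \col_(r < i) (if r == i.-1 :> nat then monic_gcd (col_head i B)
                        else 0),
        V = pad_mx n (invmx Q) &
        B' = invmx V *m B].

(* Combination of the local factors V j; p k ^+ m k is the p k-part of the last
   invariant factor. *)
Definition combine n l (p g : 'I_l -> {poly K}) (m : 'I_l -> nat)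
    (V : 'I_l -> 'M[{poly K}]_n) : 'M[{poly K}]_n :=
  \sum_j (g j * \prod_(k | k != j) p k ^+ m k) *: V j.

End MatrixPolynomials.

(* Main.v *)
(* Modulo p_j^kappa_jn the combination B_n is congruent to V_(j).  Hence det B_n
   is prime to p_j when kappa_jn > 0, and p_j^kappa_ji divides column i of A B_n.
   Since A B_n = (A V) B_1 with B_1 lower triangular and its diagonal prime to
   p_j, solving for the columns of A V from the last to the first shows that
   p_j^kappa_ji, hence d_i, divides column i of A V; this gives A V = E D.
   Finally det A and det D differ by a unit, so det E is a unit. *)

Require Import Defs.
From HB Require Import structures.
From mathcomp Require Import all_boot all_order all_algebra.

Set Implicit Arguments.
Unset Strict Implicit.
Unset Printing Implicit Defensive.

Import GRing.Theory.
Local Open Scope ring_scope.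


(** * Congruences and coprimality of polynomials *)

(** Congruence modulo [q] is stable under sums and products, so the two Leibniz expansions can be
    compared term by term. *)
Lemma dvdp_det_sub (K : fieldType) n (q : {poly K}) (A B : 'M[{poly K}]_n) :
  (forall i j, q %| A i j - B i j) -> q %| \det A - \det B.
Proof.
move=> dvAB; rewrite /determinant.
apply: (big_ind2 (fun x y => q %| x - y)) => [|x x' y y' dx dy|s _].
- by rewrite subrr dvdp0.
- by rewrite opprD addrACA dvdp_add.
rewrite -mulrBr dvdp_mull //.
apply: (big_ind2 (fun x y => q %| x - y)) => [|x x' y y' dx dy|i _].
- by rewrite subrr dvdp0.
- have -> : x * y - x' * y' = (x - x') * y + x' * (y - y').
    by rewrite mulrBl mulrBr addrA subrK.
  by apply: dvdp_add; [exact: dvdp_mulr | exact: dvdp_mull].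
- exact: dvAB.
Qed.

Lemma dvdp_prod_coprime (K : fieldType) l (q : 'I_l -> {poly K}) x :
    (forall j k, j != k -> coprimep (q j) (q k)) ->
  (forall j, q j %| x) -> \prod_j q j %| x.
Proof.
elim: l q => [|l IHl] q cop dv; first by rewrite big_ord0 dvd1p.
rewrite big_ord_recl Gauss_dvdp ?dv ?IHl // => [j k njk|].
  by apply: cop; rewrite (inj_eq lift_inj).
elim/big_rec: _ => [|j y _ IHy]; first exact: coprimep1.
by rewrite coprimepMr cop ?neq_lift.
Qed.

Lemma coprime_monic_irreducible (K : fieldType) (p q : {poly K}) :
    p \is monic -> q \is monic -> irreducible_poly p -> irreducible_poly q ->
  p != q -> coprimep p q.
Proof.
move=> mp mq ip iq npq; rewrite irreducible_poly_coprime //.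
apply: contra npq => dpq; rewrite -eqp_monic //; apply: iq.2 => //.
by rewrite gtn_eqF // ip.1.
Qed.

(** The units of [{poly K}] are the nonzero constants; this gives access to [invmx] and the theory
    of [unitmx]. *)
Lemma unimodularE (K : fieldType) n (A : 'M[{poly K}]_n) :
  unimodular A <-> A \in unitmx.
Proof.
rewrite unitmxE poly_unitE; split=> [[c c0 ->]|/andP[/size_poly1P[c c0 detA] _]].
  by rewrite size_polyC c0 coefC unitfE c0.
by exists c.
Qed.

(** * Block matrices [diag(Q, I)] of full size *)

Lemma castmx_1 (R : pzSemiRingType) m n (e : m = n) :
  castmx (e, e) 1%:M = 1%:M :> 'M[R]_n.
Proof. by case: n / e. Qed.

Lemma castmxM (R : pzSemiRingType) m n (e : m = n) (A B : 'M[R]_m) :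
  castmx (e, e) (A *m B) = castmx (e, e) A *m castmx (e, e) B.
Proof. by case: n / e. Qed.

(** Given the size equation [e], the default branch of [conform_mx] is not taken and the padding is
    a plain cast. *)
Lemma pad_mxE (K : fieldType) n i (Q : 'M[{poly K}]_i)
    (e : (i + (n.+1 - i) = n.+1)%N) :
  pad_mx n Q = castmx (e, e) (block_mx Q 0 0 1%:M).
Proof. by rewrite /pad_mx -(conform_castmx (e, e)) conform_mx_id. Qed.

Lemma pad_mx1 (K : fieldType) n i : (i <= n.+1)%N ->
  pad_mx n (1%:M : 'M[{poly K}]_i) = 1%:M.
Proof.
move=> le_in; rewrite (pad_mxE _ (subnKC le_in)) -scalar_mx_block.
exact: castmx_1.
Qed.

Lemma pad_mxM (K : fieldType) n i (Q R : 'M[{poly K}]_i) : (i <= n.+1)%N ->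
  pad_mx n (Q *m R) = pad_mx n Q *m pad_mx n R.
Proof.
move=> le_in; rewrite !(pad_mxE _ (subnKC le_in)).
have <- : block_mx Q 0 0 1%:M *m block_mx R 0 0 1%:M =
    block_mx (Q *m R) 0 0 1%:M :> 'M_(i + (n.+1 - i)).
  by rewrite mulmx_block !mul0mx !mulmx0 mul1mx !addr0 !add0r.
exact: castmxM.
Qed.

Lemma pad_mx_unit (K : fieldType) n i (Q : 'M[{poly K}]_i) :
  (i <= n.+1)%N -> Q \in unitmx -> pad_mx n Q \in unitmx.
Proof.
move=> le_in uQ.
suff /mulmx1_unit[] : pad_mx n Q *m pad_mx n (invmx Q) = 1%:M by [].
by rewrite -pad_mxM // mulmxV // pad_mx1.
Qed.

Lemma invmx_pad (K : fieldType) n i (Q : 'M[{poly K}]_i) :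
  (i <= n.+1)%N -> Q \in unitmx -> invmx (pad_mx n (invmx Q)) = pad_mx n Q.
Proof.
move=> le_in uQ.
have uV : pad_mx n (invmx Q) \in unitmx by rewrite pad_mx_unit ?unitmx_inv.
by rewrite -[RHS](mulmxK uV) -pad_mxM // mulmxV // pad_mx1 // mul1mx.
Qed.

Lemma mul_pad_mx_head (K : fieldType) n i (Q : 'M[{poly K}]_i)
    (B : 'M[{poly K}]_n.+1) (r : 'I_i) c : (i <= n.+1)%N ->
  (pad_mx n Q *m B) (inord r) c = \sum_s Q r s * B (inord s) c.
Proof.
move=> le_in; set e := subnKC le_in; rewrite mxE (pad_mxE _ e).
have inordE (s : 'I_i) : inord s = cast_ord e (lshift _ s).
  by apply/val_inj; rewrite /= inordK // (leq_trans (ltn_ord s)).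
rewrite (reindex (cast_ord e)) /=; last first.
  by exists (cast_ord (esym e)) => s _; rewrite ?cast_ordK ?cast_ordKV.
rewrite big_split_ord /= [X in _ + X]big1 ?addr0 => [|s _].
  apply: eq_bigr => s _.
  by rewrite !inordE castmxE /= !cast_ordK block_mxEul.
by rewrite !inordE castmxE /= !cast_ordK block_mxEur mxE mul0r.
Qed.

Lemma mul_pad_mx_tail (K : fieldType) n i (Q : 'M[{poly K}]_i)
    (B : 'M[{poly K}]_n.+1) (r c : 'I_n.+1) : (i <= n.+1)%N -> (i <= r)%N ->
  (pad_mx n Q *m B) r c = B r c.
Proof.
move=> le_in le_ir; set e := subnKC le_in; rewrite mxE (pad_mxE _ e).
have [r' rE] : exists r', r = cast_ord e (rshift _ r').
  have lt_r : (r - i < n.+1 - i)%N by rewrite ltn_sub2r // (leq_ltn_trans le_ir).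
  by exists (Ordinal lt_r); apply/val_inj; rewrite /= subnKC.
rewrite (reindex (cast_ord e)) /=; last first.
  by exists (cast_ord (esym e)) => s _; rewrite ?cast_ordK ?cast_ordKV.
rewrite rE big_split_ord /= big1 ?add0r => [|s _].
  rewrite (bigD1 r') //= [X in _ + X]big1 ?addr0 => [|s /negPf ns].
    by rewrite castmxE /= !cast_ordK block_mxEdr mxE eqxx mul1r.
  by rewrite castmxE /= !cast_ordK block_mxEdr mxE eq_sym ns mul0r.
by rewrite castmxE /= !cast_ordK block_mxEdl mxE mul0r.
Qed.

(** * Triangularization *)

Lemma triangularization_step_factor (K : fieldType) n i
    (B B' V : 'M[{poly K}]_n.+1) : (i <= n.+1)%N ->
  triangularization_step i B B' V -> V \in unitmx /\ B = V *m B'.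
Proof.
move=> le_in [Q [/unimodularE uQ _ -> ->]].
have uV : pad_mx n (invmx Q) \in unitmx by rewrite pad_mx_unit ?unitmx_inv.
by rewrite mulKVmx.
Qed.

(** Indices are 0-based: the columns from [i] on are already clear above the diagonal, and the step
    clears column [i.-1]. Rows from [i] on do not change. The other rows become combinations of the
    first [i] rows, which vanish in the columns from [i] on. *)
Lemma triangularization_step_trig (K : fieldType) n i
    (B B' V : 'M[{poly K}]_n.+1) : (0 < i <= n.+1)%N ->
    triangularization_step i B B' V ->
    (forall r c : 'I_n.+1, (r < c)%N -> (i <= c)%N -> B r c = 0) ->
  forall r c : 'I_n.+1, (r < c)%N -> (i.-1 <= c)%N -> B' r c = 0.
Proof.
case/andP=> i_gt0 le_in [Q [/unimodularE uQ Qf -> ->]] B0 r c lt_rc le_ic.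
rewrite invmx_pad //; have [le_ir|lt_ri] := leqP i r.
  by rewrite mul_pad_mx_tail // B0 // (leq_trans le_ir) // ltnW.
have -> : r = inord (Ordinal lt_ri) by apply/val_inj; rewrite /= inordK.
rewrite mul_pad_mx_head //; move: le_ic; rewrite leq_eqVlt prednK //.
case/predU1P=> [cE|le_ic]; last first.
  by rewrite big1 // => s _; rewrite B0 ?mulr0 ?inordK ?(leq_trans (ltn_ord s)).
(* In column [i.-1], row [r] lies strictly above the gcd entry of [Q f], hence in its zero part. *)
have := congr1 (fun M : 'cV_i => M (Ordinal lt_ri) 0) Qf.
rewrite !mxE /= cE ltn_eqF // => Qf0; rewrite -[RHS]Qf0.
by apply: eq_bigr => s _; rewrite mxE cE inord_val.
Qed.

Lemma triangularization (K : fieldType) n (B V : nat -> 'M[{poly K}]_n.+1) :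
    (forall i, (2 <= i <= n.+1)%N ->
       triangularization_step i (B i) (B i.-1) (V i)) ->
  let W := \prod_(i <- rev (index_iota 2 n.+2)) V i in
  [/\ W \in unitmx, B n.+1 = W *m B 1%N & is_trig_mx (B 1%N)].
Proof.
move=> step W; rewrite {}/W.
have prodV m : (m <= n)%N ->
    \prod_(i <- rev (index_iota 2 m.+2)) V i \in unitmx /\
    B m.+1 = \prod_(i <- rev (index_iota 2 m.+2)) V i *m B 1%N.
  elim: m => [_|m IHm lt_mn]; first by rewrite big_nil unitmx1 mul1mx.
  have [uW BE] := IHm (ltnW lt_mn).
  have [//|uV BV] := triangularization_step_factor _ (step m.+2 lt_mn).
  have -> : rev (index_iota 2 m.+3) = m.+2 :: rev (index_iota 2 m.+2).
    by rewrite /index_iota !subSS !subn0 -{1}(addn1 m) iotaD rev_cat.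
  by rewrite big_cons unitmx_mul uV uW BV [B _]BE mulmxA.
have [uW BE] := prodV n (leqnn n).
split=> //; apply/is_trig_mxP => r c lt_rc.
(* After [m] steps the columns from [n.+1 - m] on are clear above the diagonal. For [m = n] only
   column 0 is left, and nothing lies above its diagonal entry. *)
suff trig m : (m <= n)%N -> forall r c : 'I_n.+1, (r < c)%N ->
    (n.+1 - m <= c)%N -> B (n.+1 - m)%N r c = 0.
  have := trig n (leqnn n) r c lt_rc; rewrite subSnn; apply.
  exact: leq_ltn_trans lt_rc.
elim: m => [_ r' c' _|m IHm lt_mn].
  by rewrite subn0 leqNgt ltn_ord.
rewrite subnS; apply: triangularization_step_trig (step _ _) (IHm (ltnW lt_mn)).
  by rewrite subn_gt0 ltnS ltnW //= leq_subr.
by rewrite leq_subr ltn_subRL addn1 ltnS lt_mn.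
Qed.

(** * Divisibility of columns *)

Lemma dvdp_col_mul_trig (K : fieldType) n (M T : 'M[{poly K}]_n)
    (q : 'I_n -> {poly K}) :
    is_trig_mx T -> (forall i, coprimep (q i) (T i i)) ->
    (forall i j : 'I_n, (i <= j)%N -> q i %| q j) ->
    (forall i r, q i %| (M *m T) r i) ->
  forall i r, q i %| M r i.
Proof.
move=> /is_trig_mxP trigT cop mono dv i.
(* Induction on [n - i] starts from the last column. In column [i] of [M *m T] the terms with
   [j > i] are divisible by [q j], hence by [q i]; the remaining factor [T i i] is removed by
   coprimality. *)
have [m] := ubnP (n - i); elim: m i => // m IHm i le_m r.
have := dv i r; rewrite mxE (bigD1 i) //= dvdp_addl ?Gauss_dvdpl //.
elim/big_ind: _ => [|x y|j nij]; [exact: dvdp0 | exact: dvdp_add |].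
have [lt_ij|lt_ji|/val_inj eij] := ltngtP i j; last by rewrite eij eqxx in nij.
  rewrite dvdp_mulr // (dvdp_trans (mono i j (ltnW lt_ij))) // IHm //.
  by apply: leq_trans (ltn_sub2l (ltn_ord i) lt_ij) _; rewrite -ltnS.
by rewrite trigT // mulr0 dvdp0.
Qed.

Lemma mulmx_diag_poly (K : fieldType) m n (M : 'M[{poly K}]_(m, n))
    (d : 'I_n -> {poly K}) r i :
  (M *m diag_poly d) r i = M r i * d i.
Proof. by rewrite mul_mx_diag !mxE. Qed.

(* The coefficient of V k in the combination is divisible by p j ^+ m j for
   k != j, hence congruent to 1 modulo p j ^+ m j for k = j. *)
Lemma dvdp_combine_sub (K : fieldType) n l (p g : 'I_l -> {poly K})
    (m : 'I_l -> nat) (V : 'I_l -> 'M[{poly K}]_n) j r i :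
    \sum_j g j * \prod_(k | k != j) p k ^+ m k = 1 ->
  p j ^+ m j %| combine p g m V r i - V j r i.
Proof.
pose h j := g j * \prod_(k | k != j) p k ^+ m k => sum_h.
have -> : combine p g m V r i - V j r i = \sum_k h k * (V k r i - V j r i).
  have {1}-> : V j r i = \sum_k h k * V j r i.
    by rewrite -mulr_suml sum_h mul1r.
  by rewrite /combine summxE -sumrB; apply: eq_bigr => k _; rewrite mxE mulrBr.
elim/big_ind: _ => [|x y|k _]; [exact: dvdp0 | exact: dvdp_add |].
have [->|nkj] := eqVneq k j; first by rewrite subrr mulr0 dvdp0.
by rewrite dvdp_mulr // /h (bigD1 j) 1?eq_sym //= mulrCA dvdp_mulr.
Qed.

Lemma mulmx_combine (K : fieldType) n l (p g : 'I_l -> {poly K}) m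
    (A : 'M[{poly K}]_n) V :
  A *m combine p g m V = combine p g m (fun j => A *m V j).
Proof.
by rewrite /combine mulmx_sumr; apply: eq_bigr => j _; rewrite scalemxAr.
Qed.

Theorem proposition15 (K : fieldType) (n : nat) (A : 'M[{poly K}]_n.+1)
  (regA : regular A)
  (* the Smith form of A *)
  (d : 'I_n.+1 -> {poly K}) (smithA : is_smith_form A d)
  (* factorization of det A, and exponents of the invariant factors *)
  (c : K) (l : nat) (p : 'I_l -> {poly K}) (kappa : 'I_l -> nat)
  (c_neq0 : c != 0) (l_gt0 : (0 < l)%N)
  (p_inj : injective p)
  (p_monic : forall j, p j \is monic)
  (p_irr : forall j, irreducible_poly (p j))
  (kappa_gt0 : forall j, (0 < kappa j)%N)
  (detA : \det A = c *: \prod_j p j ^+ kappa j)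
  (kap : 'I_l -> 'I_n.+1 -> nat)
  (d_fact : forall i, d i = \prod_j p j ^+ kap j i)
  (* local Smith forms *)
  (Vloc Eloc : 'I_l -> 'M[{poly K}]_n.+1)
  (local_smith : forall j,
     is_local_smith_form (p j) A (kap j) (Vloc j) (Eloc j))
  (* combination; size q <= m means deg q < m *)
  (g : 'I_l -> {poly K})
  (g_deg : forall j, (size (g j) <= (size (p j)).-1 * kap j ord_max)%N)
  (g_bezout : \sum_j g j * \prod_(k | k != j) p k ^+ kap k ord_max = 1)
  (* triangularization, i = n.+1, ..., 2 *)
  (B V : nat -> 'M[{poly K}]_n.+1)
  (B_last : B n.+1 = combine p g (fun k => kap k ord_max) Vloc)
  (B_step : forall i, (2 <= i <= n.+1)%N ->
     triangularization_step i (B i) (B i.-1) (V i)) :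
  exists2 E : 'M[{poly K}]_n.+1, unimodular E &
    A *m (\prod_(i <- rev (index_iota 2 n.+2)) V i) = E *m diag_poly d.
Proof.
have [d_monic d_dvd [E0 [F0 [/unimodularE uE0 /unimodularE uF0 AE]]]] := smithA.
have d_mono (i j : 'I_n.+1) : (i <= j)%N -> d i %| d j.
  move=> /subnKC; move: (j - i)%N => k; elim: k j => [|k IHk] j ij.
    by rewrite (_ : j = i) //; apply/val_inj; rewrite /= -ij addn0.
  have lt_j : (i + k < n.+1)%N
    by apply: leq_trans (ltn_ord j); rewrite -ij addnS.
  apply: dvdp_trans (IHk (Ordinal lt_j) erefl) (d_dvd _ _ _).
  by rewrite -ij addnS.
have copp j k : j != k -> coprimep (p j) (p k).
  by move=> njk; rewrite coprime_monic_irreducible // (inj_eq p_inj).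
have dvd_loc (j : 'I_l) i : p j ^+ kap j i %| d i.
  by rewrite d_fact (bigD1 j) //= dvdp_mulr.
(* Monotonicity of the exponents is read off from the divisibility chain of the [d i]: the other
   prime powers in [d i'] are coprime to [p j]. *)
have q_mono j (i i' : 'I_n.+1) : (i <= i')%N -> p j ^+ kap j i %| p j ^+ kap j i'.
  move=> le_ii'; have := dvdp_trans (dvd_loc j i) (d_mono _ _ le_ii').
  rewrite d_fact (bigD1 j) //= Gauss_dvdpl // coprimep_expl //.
  elim/big_ind: _ => [|x y cx cy|k nkj]; first exact: coprimep1.
    by rewrite coprimepMr cx.
  by rewrite coprimep_expr // copp // eq_sym.
have [] := triangularization B_step.
set W := \prod_(_ <- _) _; set T := B 1%N => uW BE trigT.
have dvd_AW j i r : p j ^+ kap j i %| (A *m W) r i.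
  (* If the largest exponent is 0, congruence modulo [p j ^+ 0] says nothing about [\det (B n.+1)],
     but then all the powers to be tested divide 1. *)
  have [km0|km_gt0] := posnP (kap j ord_max).
    apply: dvdp_trans (q_mono j i ord_max _) _; first exact: leq_ord.
    by rewrite km0 dvd1p.
  have [AV nV _] := local_smith j.
  apply: (dvdp_col_mul_trig (q := fun i => p j ^+ kap j i)) (trigT) _ _ _ i r.
  - move=> i; rewrite coprimep_expl // irreducible_poly_coprime //.
    (* A factor [p j] of a diagonal entry of [T] would divide [\det (B n.+1)], hence the congruent
       [\det (Vloc j)]. *)
    apply: contra nV => dvT.
    have dvB : p j %| \det (B n.+1).
      by rewrite BE det_mulmx (det_trig trigT) (bigD1 i) //= dvdp_mull // dvdp_mulr.
    rewrite -(dvdp_subr _ dvB); apply: dvdp_det_sub => r s; rewrite B_last.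
    apply: dvdp_trans (dvdp_combine_sub Vloc j r s g_bezout).
    by rewrite -(prednK km_gt0) exprS dvdp_mulr.
  - exact: q_mono.
  move=> i r; rewrite -mulmxA -BE B_last mulmx_combine.
  have dvAV : p j ^+ kap j i %| (A *m Vloc j) r i by rewrite AV mulmx_diag_poly dvdp_mull.
  rewrite -(dvdp_subl _ dvAV).
  apply: dvdp_trans (q_mono j i ord_max (leq_ord _)) _.
  exact: (dvdp_combine_sub (fun j => A *m Vloc j)).
(* The entrywise quotients are exact: each [d i] is a product of pairwise coprime powers, all
   dividing column [i]. *)
pose E : 'M_n.+1 := \matrix_(r, i) ((A *m W) r i %/ d i).
have AWE : A *m W = E *m diag_poly d.
  apply/matrixP => r i; rewrite mulmx_diag_poly.
  rewrite [X in _ = X * _]mxE divpK // d_fact.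
  apply: dvdp_prod_coprime => // j k njk.
  by rewrite coprimep_expl // coprimep_expr // copp.
exists E => //; apply/unimodularE.
have detD : \det (diag_poly d) != 0.
  by apply: contraNneq regA => D0; rewrite AE !det_mulmx D0 mulr0 mul0r.
(* Determinants of [E0 D F0 W = E D]; cancelling the nonzero [\det D] leaves [\det E] as a product
   of three units. *)
have detE : \det E0 * \det F0 * \det W * \det (diag_poly d) =
    \det E * \det (diag_poly d).
  by rewrite -(det_mulmx E) -AWE AE !det_mulmx mulrAC (mulrAC (\det E0)).
by rewrite unitmxE -(mulIf detD detE) !unitrM -!unitmxE uE0 uF0.
Qed.
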